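(* Let $S$ be a semiring and $*: S \to S$, $s\mapsto s^*$, a pc-function such that $0^*=1$ and $(s+s^* )^* = 0$ for any $s\in S$. If $P$ is a prime ideal of $S$, then the following statements are equivalent: (1) For each $s\in S$, if $s\in P$, then $s^* \notin P$. (2) For each $s\in S$, if $s\in P$, then $s^{**} \in P$. (3) $P \cap \{s\in S: s^* = 0 \} = \emptyset$.
   Context: A semiring is a set $S$ with operations $+,\cdot$ such that $(S,+)$ is a commutative monoid with identity $0$, $(S,\cdot)$ is a commutative monoid with identity $1\neq 0$, multiplication distributes over addition, and $s\cdot 0=0$ for all $s\in S$. A nonempty subset $I\subseteq S$ is an ideal if $a+b\in I$ and $sa\in I$ for all $a,b\in I$, $s\in S$. An ideal $P\neq S$ is prime if $ab\in P$ implies $a\in P$ or $b\in P$. A function $*:S\to S$, written $s\mapsto s^*$, is a pc-function (pseudocomplemented function) if $s\cdot s^*=0$ for all $s\in S$. Write $s^{**}=(s^* )^*$. *)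

(* Defs.v *)
From mathcomp Require Import all_boot all_algebra.
From mathcomp Require Import classical_sets.

Set Implicit Arguments.
Unset Strict Implicit.
Unset Printing Implicit Defensive.

Import GRing.Theory.
Local Open Scope classical_set_scope.
Local Open Scope ring_scope.

(* MathComp's ideals (ring_quotient) require a ring with subtraction and
   decidable membership, so ideals of a semiring are defined here on
   arbitrary subsets. *)
Definition is_ideal (S : comNzSemiRingType) (I : set S) : Prop :=
  [/\ I !=set0,
      forall a b, I a -> I b -> I (a + b) &
      forall s a, I a -> I (s * a)].

Definition is_prime_ideal (S : comNzSemiRingType) (P : set S) : Prop :=
  [/\ is_ideal P,
      P <> setT &
      forall a b, P (a * b) -> P a \/ P b].

Definition pc_function (S : comNzSemiRingType) (pc : S -> S) : Prop :=
  forall s, s * pc s = 0.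

(* Main.v *)
Require Import Defs.
From mathcomp Require Import all_boot all_algebra.
From mathcomp Require Import classical_sets.

Local Open Scope classical_set_scope.
Local Open Scope ring_scope.

Lemma ideal0 (S : comNzSemiRingType) (I : set S) : is_ideal I -> I 0.
Proof. by move=> [[a Ia] _ IM]; rewrite -(GRing.mul0r a); apply: IM. Qed.

Lemma prime_ideal1 (S : comNzSemiRingType) (P : set S) :
  is_prime_ideal P -> ~ P 1.
Proof.
move=> [[_ _ PM] PT _] P1; apply: PT; apply/seteqP; split=> // s _.
by rewrite -(GRing.mulr1 s); apply: PM.
Qed.

Theorem theorem2p9 (S : comNzSemiRingType) (pc : S -> S)
  (pcP : pc_function pc) (pc0 : pc 0 = 1)
  (pcD : forall s : S, pc (s + pc s) = 0)
  (P : set S) (primeP : is_prime_ideal P) :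
  [<-> forall s : S, P s -> ~ P (pc s);
       forall s : S, P s -> P (pc (pc s));
       P `&` [set s : S | pc s = 0] = set0].
Proof.
have nP1 := prime_ideal1 _ _ primeP.
have [idealP _ PMor] := primeP.
have [_ PD _] := idealP.
tfae.
- move=> H s Ps.
  (* This product is [0]; primeness leaves only [pc (pc s)], since [H] excludes [pc s]. *)
  have : P (pc s * pc (pc s)) by rewrite pcP; apply: ideal0.
  by move=> /PMor [/(H s Ps)|].
- move=> H; apply/seteqP; split=> // s [Ps /= s0].
  (* Since [pc s = 0], [1 = pc 0 = pc (pc s)], which [H] places in [P]. *)
  by apply: nP1; rewrite -pc0 -s0; apply: H.
- move=> H s Ps Pcs.
  (* If both [s] and [pc s] lie in [P], their sum is a witness against disjointness. *)
  suff : (P `&` [set s : S | pc s = 0]) (s + pc s) by rewrite H.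
  by split; [apply: PD | apply: pcD].
Qed.
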